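(* If $\iota: A' \hookrightarrow A$ is an open embedding of locally compact abelian groups and $D$ is a divisible (resp. strictly divisible) locally compact abelian group, then $\iota^*: \mathrm{Hom}(A,D) \to \mathrm{Hom}(A',D)$ is surjective (resp. strict and surjective).
   Context: Locally compact abelian (LCA) groups are Hausdorff. $\mathrm{Hom}(A,D)$ is the group of continuous homomorphisms with the compact-open topology, an abelian Hausdorff group. A continuous homomorphism $f: A\to B$ of abelian Hausdorff groups is strict if the induced monomorphism $A/\ker(f) \to B$ is a closed embedding. An LCA group $D$ is divisible (resp. strictly divisible) if $n \cdot: D \to D$ is surjective (resp. strict and surjective) for all integers $n \ge 1$. *)

(* Defs.v *)
From HB Require Import structures.
From mathcomp Require Import all_boot all_order all_algebra.
From mathcomp Require Import all_classical all_reals all_analysis.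

Set Implicit Arguments.
Unset Strict Implicit.
Unset Printing Implicit Defensive.

Import GRing.Theory.

Local Open Scope classical_set_scope.
Local Open Scope ring_scope.

Definition lca_group (A : topologicalZmodType) : Prop :=
  hausdorff_space A /\ locally_compact [set: A].

(* The topology of X is the one induced by g; the left-to-right direction makes
   g open onto its range, the right-to-left direction is continuity. *)
Definition embedding (X Y : topologicalType) (g : X -> Y) : Prop :=
  injective g /\
  forall U : set X, open U <-> exists2 V : set Y, open V & g @^-1` V = U.

Definition open_embedding (X Y : topologicalType) (g : X -> Y) : Prop :=
  embedding g /\ open (range g).

Definition closed_embedding (X Y : topologicalType) (g : X -> Y) : Prop :=
  embedding g /\ closed (range g).

Definition surjective (X Y : Type) (g : X -> Y) : Prop :=
  set_surj [set: X] [set: Y] g.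

(* [contHom A B] is Hom(A, B); it is made below into a topological group for
   pointwise addition and the compact-open topology. *)
#[short(type="contHom")]
HB.structure Definition ContHom (A B : topologicalZmodType) :=
  {f of @isContinuous A B f & @GRing.isNmodMorphism A B f}.

HB.instance Definition _ (A B : topologicalZmodType) :=
  gen_eqMixin (contHom A B).
HB.instance Definition _ (A B : topologicalZmodType) :=
  gen_choiceMixin (contHom A B).

Lemma contHomP (A B : topologicalZmodType) (f g : contHom A B) :
  f = g <-> f =1 g.
Proof.
split=> [->//|/funext]; case: f g => [f [[fc] [fa]]] [g [[gc] [ga]]]/= fg.
rewrite fg in fc fa *.
by rewrite (Prop_irrelevance fc gc) (Prop_irrelevance fa ga).
Qed.

Section contHom_zmodule.
Variables A B : topologicalZmodType.
Implicit Types f g h : contHom A B.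

Lemma null_fun_continuous : continuous (\0 : A -> B).
Proof. by move=> x; exact: cvg_cst. Qed.

Lemma opp_fun_continuous f : continuous (\- f : A -> B).
Proof.
by move=> x; apply: continuous_comp; [exact: cts_fun|exact: opp_continuous].
Qed.

Lemma add_fun_continuous f g : continuous (f \+ g : A -> B).
Proof.
move=> x; apply: (@continuous_comp _ _ _ (fun x => (f x, g x))
  (fun y : B * B => y.1 + y.2)); last exact: add_continuous.
by apply: cvg_pair; exact: cts_fun.
Qed.

HB.instance Definition _ :=
  @isContinuous.Build A B (\0 : A -> B) null_fun_continuous.
HB.instance Definition _ f :=
  @isContinuous.Build A B (\- f : A -> B) (@opp_fun_continuous f).
HB.instance Definition _ f g :=
  @isContinuous.Build A B (f \+ g : A -> B) (@add_fun_continuous f g).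

Definition contHom_zero : contHom A B := (\0 : A -> B).
Definition contHom_opp f : contHom A B := (\- f : A -> B).
Definition contHom_add f g : contHom A B := (f \+ g : A -> B).

Lemma contHom_addA : associative contHom_add.
Proof. by move=> f g h; apply/contHomP => x /=; rewrite addrA. Qed.

Lemma contHom_addC : commutative contHom_add.
Proof. by move=> f g; apply/contHomP => x /=; rewrite addrC. Qed.

Lemma contHom_add0 : left_id contHom_zero contHom_add.
Proof. by move=> f; apply/contHomP => x /=; rewrite add0r. Qed.

Lemma contHom_addN : left_inverse contHom_zero contHom_opp contHom_add.
Proof. by move=> f; apply/contHomP => x /=; rewrite addNr. Qed.

HB.instance Definition _ := GRing.isZmodule.Build (contHom A B)
  contHom_addA contHom_addC contHom_add0 contHom_addN.

End contHom_zmodule.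

HB.instance Definition _ (A B : topologicalZmodType) :=
  Topological.copy (contHom A B)
    (initial_topology (id : contHom A B -> {compact-open, A -> B})).

Lemma topologicalZmod_regular (B : topologicalZmodType) : regular_space B.
Proof.
move=> a U aU.
have : nbhs (a - 0) U by rewrite subr0.
move=> /(@sub_continuous B (a, 0)) [[V N]] /= [aV N0] VNU.
exists V => // y yV.
have cty : {for y, continuous (fun z => z - y)}.
  apply: (@continuous_comp _ _ _ (fun z => (z, y))
    (fun z : B * B => z.1 - z.2)); last exact: sub_continuous.
  by apply: cvg_pair => //=; exact: cvg_cst.
have yN : nbhs y ((fun z => z - y) @^-1` N) by apply: cty; rewrite subrr.
have [z [Vz Nz]] := yV _ yN.
have -> : y = z - (z - y) by rewrite opprB addrC subrK.
exact: (VNU (z, z - y)).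
Qed.

Section contHom_topology.
Variables A B : topologicalZmodType.

Lemma contHom_cvgP (F : set_system (contHom A B)) (f : contHom A B) :
  Filter F ->
  F --> f <-> forall K O, compact K -> open O -> f @` K `<=` O ->
    F [set g : contHom A B | g @` K `<=` O].
Proof.
move=> FF; split=> [Ff K O cK oO fKO|FO].
  apply: Ff; exists [set g : contHom A B | g @` K `<=` O]; split => //.
  by exists [set g | g @` K `<=` O] => //; exact: compact_open_open.
move=> U [_ [[V oV <-] Vf VU]]; apply: filterS VU _.
pose i (g : contHom A B) : {compact-open, A -> B} := g.
have : nbhs (i f) V by exact: open_nbhs_nbhs.
suff /compact_open_cvgP : forall K O, compact K -> open O ->
    i f @` K `<=` O -> (i @ F) [set g | g @` K `<=` O].
  by apply.
exact: FO.
Qed.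

Lemma contHom_nbhs (f : contHom A B) K O :
  compact K -> open O -> f @` K `<=` O ->
  nbhs f [set g : contHom A B | g @` K `<=` O].
Proof. by move=> cK oO fKO; apply: (contHom_cvgP f _).1. Qed.

Lemma contHom_sub_continuous :
  continuous (fun x : contHom A B * contHom A B => x.1 - x.2).
Proof.
move=> [f g]; apply/contHom_cvgP => K O cK oO fgKO.
suff : nbhs (f, g) [set h : contHom A B * contHom A B |
    K `<=` (fun x => O (h.1 x - h.2 x))].
  by apply: filterS => h hK _ [x Kx <-]; exact: hK.
have /compact_near_coveringP/near_covering_withinP covK := cK.
apply: (covK _ (nbhs (f, g))
  (fun (h : contHom A B * contHom A B) y => O (h.1 y - h.2 y))) => x Kx.
have Ofg : nbhs (f x - g x) O.
  by apply: open_nbhs_nbhs; split => //; apply: fgKO; exists x.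
have [[U V] /= [Uf Vg] UVO] := @sub_continuous B (f x, g x) _ Ofg.
have shrink (h : contHom A B) (W : set B) : nbhs (h x) W ->
    exists2 C, nbhs x C &
      nbhs h [set k : contHom A B | k @` (K `&` C) `<=` W].
  move=> /nbhs_interior/topologicalZmod_regular[W' W'h W'W].
  exists (h @^-1` closure W').
    by apply: cts_fun; apply: filterS W'h; exact: subset_closure.
  have cC : compact (K `&` h @^-1` closure W').
    apply: compact_closedI => //; apply: preimage_closed.
      by move=> y _; exact: cts_fun.
    exact: closed_closure.
  have hC : h @` (K `&` h @^-1` closure W') `<=` W°.
    by move=> _ [y [_ /W'W Wy] <-].
  apply: filterS (contHom_nbhs cC (@open_interior _ _) hC) => k kC.
  by apply: subset_trans kC _; exact: interior_subset.
have [C Cx CU] := shrink f U Uf.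
have [E Ex EV] := shrink g V Vg.
exists (C `&` E, [set h : contHom A B * contHom A B |
    h.1 @` (K `&` C) `<=` U /\ h.2 @` (K `&` E) `<=` V]).
  split; first exact: filterI.
  by exists ([set k : contHom A B | k @` (K `&` C) `<=` U],
    [set k : contHom A B | k @` (K `&` E) `<=` V]).
move=> [y [h k]] /= [[Cy Ey] [hU kV]] Ky.
by apply: (UVO (h y, k y)); split; [apply: hU|apply: kV]; exists y.
Qed.

HB.instance Definition _ :=
  PreTopologicalNmodule_isTopologicalZmodule.Build (contHom A B)
    contHom_sub_continuous.

Lemma contHom_hausdorff : hausdorff_space B -> hausdorff_space (contHom A B).
Proof.
rewrite !open_hausdorff => hB f g fg.
have /existsNP[x /eqP/hB[[U V] /= []]] : ~ f =1 g.
  by move/contHomP; exact/eqP.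
rewrite !inE => Ux Vx [oU oV UV].
pose ev (W : set B) := [set h : contHom A B | h @` [set x] `<=` W].
have ev_open W : open W -> open (ev W).
  move=> oW; exists [set h | h @` [set x] `<=` W] => //.
  by apply: compact_open_open => //; exact: compact_set1.
exists (ev U, ev V); first by rewrite !inE; split=> _ [_ -> <-].
split; [exact: ev_open|exact: ev_open|].
apply/eqP; rewrite -subset0 => h [/= hU hV].
suff : (U `&` V) (h x) by rewrite UV.
by split; [apply: hU|apply: hV]; exists x.
Qed.

End contHom_topology.

Section strict.
Local Open Scope quotient_scope.
Variables (A B : topologicalZmodType) (f : contHom A B).

Definition contHom_ker : {pred A} := [pred x | f x == 0].

Lemma contHom_ker_zmod_closed : zmod_closed contHom_ker.
Proof.
split=> [|x y]; rewrite !inE/= ?raddf0// => /eqP fx /eqP fy.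
by rewrite raddfB /= fx fy subrr.
Qed.

HB.instance Definition _ :=
  GRing.isZmodClosed.Build A contHom_ker contHom_ker_zmod_closed.

(* A / ker f with the quotient topology. *)
Definition quot_ker := quotient_topology (Quotient.quot contHom_ker).

HB.instance Definition _ := Topological.on quot_ker.
HB.instance Definition _ := Quotient.on quot_ker.

(* The monomorphism A / ker f -> B induced by f, defined by means of a choice of
   representatives; see [quot_ker_map_pi]. *)
Definition quot_ker_map (q : quot_ker) : B := f (repr q).

Lemma quot_ker_map_pi (x : A) : quot_ker_map (\pi_quot_ker x) = f x.
Proof.
have : repr (\pi_quot_ker x) = x %[mod Quotient.quot contHom_ker].
  by rewrite reprK.
by move/eqP; rewrite -Quotient.idealrBE inE/= raddfB subr_eq0 => /eqP.
Qed.

Definition strict : Prop := closed_embedding quot_ker_map.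

End strict.

Section divisible.
Variable D : topologicalZmodType.

Definition mulrn_fun (n : nat) (x : D) : D := x *+ n.

Lemma mulrn_fun_continuous n : continuous (mulrn_fun n).
Proof.
elim: n => [|n IHn] x.
  by rewrite (_ : mulrn_fun 0 = cst 0); [exact: cvg_cst|exact/funext].
rewrite (_ : mulrn_fun n.+1 = fun y => y + mulrn_fun n y); last first.
  by apply/funext => y; rewrite /mulrn_fun mulrS.
apply: (@continuous_comp _ _ _ (fun y => (y, mulrn_fun n y))
  (fun y : D * D => y.1 + y.2)); last exact: add_continuous.
by apply: cvg_pair => //; exact: IHn.
Qed.

Lemma mulrn_fun_nmod_morphism n : nmod_morphism (mulrn_fun n).
Proof. by split=> [|x y]; rewrite /mulrn_fun ?mul0rn ?mulrnDl. Qed.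

HB.instance Definition _ n :=
  @isContinuous.Build D D (mulrn_fun n) (@mulrn_fun_continuous n).
HB.instance Definition _ n :=
  GRing.isNmodMorphism.Build D D (mulrn_fun n) (mulrn_fun_nmod_morphism n).

Definition mulrn_hom (n : nat) : contHom D D := mulrn_fun n.

Definition divisible : Prop :=
  forall n, (1 <= n)%N -> surjective (mulrn_hom n).

Definition strictly_divisible : Prop :=
  forall n, (1 <= n)%N -> strict (mulrn_hom n) /\ surjective (mulrn_hom n).

End divisible.

Section contHom_comp.
Variables (A B C : topologicalZmodType).
Variables (g : contHom B C) (f : contHom A B).

HB.instance Definition _ := Continuous.on (g \o f : A -> C).

End contHom_comp.

Section pullback.
Variables (A' A D : topologicalZmodType) (i : contHom A' A).

Definition pullback_fun (f : contHom A D) : contHom A' D := (f \o i : A' -> D).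

Lemma pullback_fun_continuous : continuous pullback_fun.
Proof.
move=> f; apply: (contHom_cvgP (pullback_fun f)
  (fmap_filter _ (nbhs_filter f))).2 => K O cK oO fiKO.
have ciK : compact (i @` K).
  by apply: continuous_compact => //; apply: continuous_subspaceT; exact: cts_fun.
rewrite /= -image_comp in fiKO.
by apply: filterS (contHom_nbhs ciK oO fiKO) => g; rewrite /= -image_comp.
Qed.

Lemma pullback_fun_nmod_morphism : nmod_morphism pullback_fun.
Proof. by split=> [|f g]; apply/contHomP. Qed.

HB.instance Definition _ := @isContinuous.Build (contHom A D) (contHom A' D)
  pullback_fun pullback_fun_continuous.
HB.instance Definition _ := GRing.isNmodMorphism.Build
  (contHom A D) (contHom A' D) pullback_fun pullback_fun_nmod_morphism.

Definition pullback : contHom (contHom A D) (contHom A' D) := pullback_fun.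

End pullback.

(* Main.v *)
From HB Require Import structures.
Require Import Defs.
From mathcomp Require Import all_boot all_order all_algebra.
From mathcomp Require Import all_classical all_reals all_analysis.

Set Implicit Arguments.
Unset Strict Implicit.
Unset Printing Implicit Defensive.

Import GRing.Theory Num.Theory.

Local Open Scope classical_set_scope.
Local Open Scope ring_scope.

(** Surjectivity is the injectivity of divisible groups: a homomorphism on [A']
    extends to [A] by Zorn's lemma ([partial_hom_extend]), and every additive
    extension is continuous, because it is continuous on an open subgroup
    ([contHom_extend]).

    For strictness, a surjective homomorphism is strict exactly when it is open
    ([strict_surjP]). This is used in both directions: it turns the hypothesis
    on [D] into the openness of multiplication by [n >= 1], and it reduces the
    conclusion to an extension problem with estimates: given a compact [K] in
    [A] and a neighbourhood [O] of [0] in [D], every homomorphism on [A'] that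
    is small enough on a suitable compact set of [A'] should have an extension
    that maps [K] into [O].

    Only finitely many cosets of [A'] meet [K], so [K] lies in a subgroup
    obtained from [A'] by adjoining finitely many elements, one at a time. To
    extend from an open subgroup [H] to [H + Z a] one has to choose a value [d]
    at [a] ([open_extension_adjoin]). If no nonzero multiple of [a] is in [H],
    then [d = 0] works. Otherwise let [n] be least with [n a] in [H]: the value
    at [n a] is small provided that [n a] was put in the compact set, and since
    multiplication by [n] is open it has a small [n]-th part [d]. As [K] meets
    finitely many cosets [k a + H], the extension [h + k a |-> f h + k d] is
    small on [K] if [f] is small on the compact sets [(K - k a) :&: H] and [d]
    is small. Beyond the subgroup that contains [K] no estimate is left to
    satisfy, and divisibility gives an extension to all of [A]. *)

(** * Subgroups and partial homomorphisms *)

Definition subgroup (V : zmodType) (H : set V) : Prop :=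
  H 0 /\ forall x y, H x -> H y -> H (x - y).

Definition adjoin (V : zmodType) (H : set V) (a : V) : set V :=
  [set x | exists k : int, H (x - a *~ k)].

Section subgroup_theory.
Variable V : zmodType.
Implicit Types (H : set V) (a x y : V) (k : int).

Lemma subgroupN H x : subgroup H -> H x -> H (- x).
Proof. by case=> H0 HB Hx; rewrite -(sub0r x); exact: HB. Qed.

Lemma subgroupD H x y : subgroup H -> H x -> H y -> H (x + y).
Proof.
move=> sH Hx Hy; rewrite -(opprK y); apply: (sH.2 _ _ Hx).
exact: subgroupN.
Qed.

Lemma subgroupMz H x k : subgroup H -> H x -> H (x *~ k).
Proof.
move=> sH Hx; have HM n : H (x *+ n).
  by elim: n => [|n IH]; [exact: sH.1|rewrite mulrS; exact: subgroupD].
case: k => n; first exact: HM.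
by apply: subgroupN => //; exact: HM.
Qed.

Lemma sub_adjoin H a : H `<=` adjoin H a.
Proof. by move=> x Hx; exists 0; rewrite mulr0z subr0. Qed.

Lemma adjoin_gen H a : subgroup H -> adjoin H a a.
Proof. by case=> H0 _; exists 1; rewrite mulr1z subrr. Qed.

Lemma subgroup_adjoin H a : subgroup H -> subgroup (adjoin H a).
Proof.
move=> sH; split; first by apply: sub_adjoin; exact: sH.1.
move=> x y [k Hx] [l Hy]; exists (k - l).
rewrite (_ : _ - _ = (x - a *~ k) - (y - a *~ l)).
  exact: (sH.2 _ _ Hx Hy).
by rewrite mulrzBr !opprB [LHS]addrACA [RHS]addrACA [- y - _]addrC.
Qed.

(** The multiples of [a] that lie in [H] are those by the elements of a
    subgroup of the integers, which is trivial or generated by its least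
    positive element. *)
Lemma multiples_in_subgroup H a : subgroup H ->
  (forall k, H (a *~ k) -> k = 0) \/
  exists n : nat, [/\ (0 < n)%N, H (a *+ n) &
    forall k, H (a *~ k) -> exists q, k = n%:Z * q].
Proof.
move=> sH; pose P n := (0 < n)%N && `[< H (a *+ n) >].
have absP k : H (a *~ k) -> k = 0 \/ P `|k|%N.
  move=> Hk; have [->|k0] := eqVneq k 0; [by left|right].
  rewrite /P absz_gt0 k0/=; apply/asboolP.
  case: k {k0} Hk => n; rewrite ?NegzE ?abszN !absz_nat // => Hn.
  by rewrite -[a *+ _]opprK; exact: subgroupN.
have [exP|nP] := pselect (exists n, P n); [right|left]; last first.
  by move=> k /absP[//|Pk]; case: nP; exists `|k|%N.
case: (ex_minnP exP) => n /andP[n0 /asboolP Hn] nmin.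
exists n; split => // k Hk; exists (k %/ n)%Z.
have nZ : n%:Z != 0 by rewrite -lt0n.
have Hr : H (a *~ (k %% n)%Z).
  rewrite /modz mulrzBr; apply: sH.2 => //.
  by rewrite mulrC mulrzA; exact: subgroupMz.
have {Hr} [r0|/nmin] := absP _ Hr.
  by rewrite {1}(divz_eq k n) r0 addr0 mulrC.
rewrite leqNgt -ltz_nat gez0_abs ?modz_ge0// => /negP[].
by rewrite ltz_pmod.
Qed.

End subgroup_theory.

Lemma mulrz_pair (A D : zmodType) (a : A) (d : D) (k : int) :
  (a, d) *~ k = (a *~ k, d *~ k).
Proof.
rewrite [LHS]surjective_pairing; congr pair.
- exact: (raddfMz fst).
- exact: (raddfMz snd).
Qed.

(** A homomorphism from a subgroup of [A] to [D] is encoded by its graph, so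
    that extending it means enlarging a set. *)
Definition partial_hom (A D : zmodType) (G : set (A * D)) : Prop :=
  subgroup G /\ forall e, G (0, e) -> e = 0.

Definition dom (A D : zmodType) (G : set (A * D)) : set A :=
  [set x | exists e, G (x, e)].

Definition nat_divisible (D : zmodType) : Prop :=
  forall n (e : D), (0 < n)%N -> exists d, d *+ n = e.

Section partial_hom_theory.
Variables A D : zmodType.
Implicit Types (G : set (A * D)) (a x : A) (d e : D).

Lemma partial_hom_uniq G x e e' :
  partial_hom G -> G (x, e) -> G (x, e') -> e = e'.
Proof.
case=> sG G0 Ge Ge'; apply/eqP; rewrite -subr_eq0; apply/eqP/G0.
by have : G (x - x, e - e') := sG.2 _ _ Ge Ge'; rewrite subrr.
Qed.

Lemma subgroup_dom G : partial_hom G -> subgroup (dom G).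
Proof.
move=> [sG _]; split; first by exists 0; exact: sG.1.
by move=> x y [e Ge] [e' Ge']; exists (e - e'); exact: sG.2 Ge Ge'.
Qed.

Lemma dom_adjoin G a d : dom (adjoin G (a, d)) = adjoin (dom G) a.
Proof.
apply/seteqP; split=> x.
  by move=> [e [k]]; rewrite mulrz_pair => Gk; exists k; exists (e - d *~ k).
move=> [k [e Ge]]; exists (e + d *~ k), k; rewrite mulrz_pair.
by change (G (x - a *~ k, e + d *~ k - d *~ k)); rewrite addrK.
Qed.

(** The value [d] can be prescribed at [a] as soon as it agrees with [G] on the
    multiples of [a] that are in its domain. *)
Lemma partial_hom_adjoin G a d : partial_hom G ->
  (forall k e, G (a *~ k, e) -> e = d *~ k) -> partial_hom (adjoin G (a, d)).
Proof.
move=> [sG G0] Gd; split; first exact: subgroup_adjoin.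
move=> e [k]; rewrite mulrz_pair => Gk.
have {Gk} : G (0 - a *~ k, e - d *~ k) by [].
rewrite sub0r -mulrNz => /Gd; rewrite mulrNz => /eqP.
by rewrite subr_eq addNr => /eqP.
Qed.

(** If every multiple of [a] in the domain is a multiple of [n a], agreement at
    [n a] alone is enough. *)
Lemma partial_hom_root G a d n e : partial_hom G ->
  (forall k, dom G (a *~ k) -> exists q, k = n%:Z * q) ->
  G (a *+ n, e) -> d *+ n = e -> forall k f, G (a *~ k, f) -> f = d *~ k.
Proof.
move=> pG nP Ge de k f Gf.
have [|q kq] := nP k; first by exists f.
apply: (partial_hom_uniq pG Gf); rewrite kq !mulrzA -!pmulrn de -mulrz_pair.
by apply: subgroupMz => //; exact: pG.1.
Qed.

Lemma partial_hom_value G a : nat_divisible D -> partial_hom G ->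
  exists d, forall k e, G (a *~ k, e) -> e = d *~ k.
Proof.
move=> divD pG.
have [domG|[n [n0 [e Ge] nP]]] := multiples_in_subgroup a (subgroup_dom pG).
  exists 0 => k e Gk; have k0 : k = 0 by apply: domG; exists e.
  by rewrite mul0rz; apply: pG.2; rewrite k0 mulr0z in Gk.
by have [d de] := divD n e n0; exists d; exact: partial_hom_root Ge de.
Qed.

(** Divisible groups are injective: by Zorn's lemma there is a maximal
    extension, and its domain is the whole group because a value can always be
    chosen at one more element. *)
Lemma partial_hom_extend G : nat_divisible D -> partial_hom G ->
  exists2 g : A -> D, nmod_morphism g & forall x e, G (x, e) -> g x = e.
Proof.
move=> divD pG.
(* The empty chain has an empty union, hence the union with [G]. *)
have [F Fch pF|M [pM maxM]] :=
    @Zorn_bigcup (A * D) (fun X => partial_hom (G `|` X)).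
  have chain p q : (G `|` \bigcup_(X in F) X) p ->
      (G `|` \bigcup_(X in F) X) q -> exists X, [/\ partial_hom (G `|` X),
      (G `|` X) p, (G `|` X) q & G `|` X `<=` G `|` \bigcup_(X in F) X].
    have FU X : F X -> G `|` X `<=` G `|` \bigcup_(X in F) X.
      by move=> FX; apply: setUS; exact: bigcup_sup.
    move=> [Gp|[X FX Xp]] [Gq|[Y FY Yq]].
    - by exists set0; rewrite setU0; split.
    - by exists Y; split; [exact: Fch|left|right|exact: FU].
    - by exists X; split; [exact: Fch|right|left|exact: FU].
    - have [XY|YX] := pF _ _ FX FY.
      + by exists Y; split; [exact: Fch|right; exact: XY|right|exact: FU].
      + by exists X; split; [exact: Fch|right|right; exact: YX|exact: FU].
  split; first split.
  - by left; exact: pG.1.1.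
  - by move=> p q /chain/[apply] -[X [pX Xp Xq]]; apply; exact: pX.1.2.
  - move=> e Ge; have [X [pX Xe _ _]] := chain _ _ Ge Ge.
    exact: pX.2.
have {}maxM a d : partial_hom (adjoin (G `|` M) (a, d)) ->
    (G `|` M) (a, d).
  move=> pa; set N := adjoin _ _ in pa.
  have GN : G `|` M `<=` N by exact: sub_adjoin.
  have Nad : N (a, d) by apply: adjoin_gen; exact: pM.1.
  apply: contrapT => nad; apply: (maxM N); last first.
    by rewrite setUidr // => p Gp; apply: GN; left.
  split=> [p Mp|NM]; first by apply: GN; right.
  by apply: nad; right; exact: NM.
have total a : exists d, (G `|` M) (a, d).
  have [d ad] := partial_hom_value a divD pM.
  by exists d; apply: maxM; exact: partial_hom_adjoin.
have [g gM] := choice total.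
have addg : nmod_morphism g.
  split; first by apply: (partial_hom_uniq pM (gM 0)); exact: pM.1.1.
  move=> x y; apply: (partial_hom_uniq pM (gM _)).
  exact: (subgroupD pM.1 (gM x) (gM y)).
exists g => // x e Ge.
by apply: (partial_hom_uniq pM (gM x)); left.
Qed.

End partial_hom_theory.

(** * Topological groups *)

Section topological_group.
Variable V : topologicalZmodType.
Implicit Types (H U K : set V) (a x : V).

Lemma addl_continuous a : continuous (fun x : V => a + x).
Proof.
move=> x; apply: (@continuous_comp _ _ _ (fun y => (a, y))
  (fun p : V * V => p.1 + p.2)); last exact: add_continuous.
by apply: cvg_pair => //; exact: cvg_cst.
Qed.

Lemma mulrz_continuous k : continuous (fun x : V => x *~ k).
Proof.
case: k => n; first exact: (@mulrn_fun_continuous V n).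
move=> x; apply: (@continuous_comp _ _ _ (fun y : V => y *+ n.+1) -%R).
  exact: (@mulrn_fun_continuous V n.+1).
exact: opp_continuous.
Qed.

Lemma nbhs_translate a U : nbhs a U <-> nbhs 0 [set x | U (a + x)].
Proof.
split=> [aU|].
  by apply: (@addl_continuous a 0); rewrite addr0.
move=> U0; have : nbhs a ((fun x => - a + x) @^-1` [set x | U (a + x)]).
  by apply: (@addl_continuous (- a) a); rewrite addNr.
by apply: filterS => x /=; rewrite addrA subrr add0r.
Qed.

Lemma open_translate a U : open U -> open [set x | U (a + x)].
Proof. by move/continuousP: (@addl_continuous a); apply. Qed.

Lemma open_adjoin H a : open H -> open (adjoin H a).
Proof.
move=> oH; rewrite (_ : adjoin H a = \bigcup_k [set x | H (- (a *~ k) + x)]).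
  by apply: bigcup_open => k _; exact: open_translate.
apply/seteqP; split=> x [k]; first by move=> Hx; exists k => //=; rewrite addrC.
by move=> _ /=; rewrite addrC; exists k.
Qed.

(** The complement of an open subgroup is a union of cosets. *)
Lemma open_subgroup_closed H : subgroup H -> open H -> closed H.
Proof.
move=> sH oH; rewrite -openC openE => x nHx.
apply: (nbhs_translate _ _).2; have : nbhs 0 H.
  by apply: open_nbhs_nbhs; split=> //; exact: sH.1.
apply: filterS => y Hy /= Hxy; apply: nHx.
by rewrite -(addrK y x); exact: sH.2.
Qed.

Lemma compact_translate K a : compact K -> compact [set x | K (a + x)].
Proof.
move=> cK; rewrite (_ : [set _ | _] = (fun x => - a + x) @` K).
  apply: continuous_compact => //; apply: continuous_subspaceT.
  exact: addl_continuous.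
apply/seteqP; split=> x /=.
  by exists (a + x) => //; rewrite addrA addNr add0r.
by move=> [y Ky <-]; rewrite addrA subrr add0r.
Qed.

Lemma compact_cosets (I : eqType) (c : I -> V) H K : subgroup H -> open H ->
  compact K -> (forall x, K x -> exists i, H (x - c i)) ->
  exists s : seq I, forall x, K x -> exists2 i, i \in s & H (x - c i).
Proof.
move=> sH oH /compact_near_coveringP cK Kc.
(* The finite index sets, ordered by inclusion. *)
pose F := filter_from setT (fun t : seq I => [set s : seq I | {subset t <= s}]).
have FF : Filter F.
  apply: filter_from_filter; first by exists [::].
  move=> s t _ _; exists (s ++ t) => // u stu.
  by split=> i it; apply: stu; rewrite mem_cat it ?orbT.
have [x Kx|t _ /(_ t)] :=
    cK (seq I) F (fun s x => exists2 i, i \in s & H (x - c i)) FF.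
  have [i Hi] := Kc x Kx.
  exists ([set y | H (- c i + y)],
          [set s : seq I | {subset [:: i] <= s}]) => /=.
    split; last by exists [:: i].
    apply: open_nbhs_nbhs; split; first exact: open_translate.
    by rewrite /= addrC.
  move=> [y s] /= [Hy si]; exists i; last by rewrite addrC.
  by apply: si; rewrite inE.
by move=> tK; exists t; apply: tK.
Qed.

End topological_group.

(** * Strict surjections are open maps *)

(** For a homomorphism, translations propagate this to openness at every point;
    see [open_at0_image]. *)
Definition open_at0 (A B : topologicalZmodType) (f : contHom A B) : Prop :=
  forall U, nbhs 0 U -> nbhs 0 (f @` U).

Section strict_surjection.
Local Open Scope quotient_scope.
Variables (A B : topologicalZmodType) (f : contHom A B).

Lemma pi_quot_ker_eq (x y : A) :
  f x = f y -> \pi_(quot_ker f) x = \pi_(quot_ker f) y.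
Proof.
move=> fxy; have -> // : x = y %[mod Quotient.quot (contHom_ker f)].
by apply/eqP; rewrite -Quotient.idealrBE inE/= raddfB /= fxy subrr.
Qed.

Lemma quot_ker_map_inj : injective (@quot_ker_map A B f).
Proof.
move=> p q fpq; rewrite -[p]reprK -[q]reprK.
exact: pi_quot_ker_eq.
Qed.

(** The saturation of an open set is the union of its translates by the
    kernel. *)
Lemma pi_quot_ker_open (U : set A) :
  open U -> open (\pi_(quot_ker f) @` U : set (quot_ker f)).
Proof.
move=> oU; rewrite /open/= /quotient_open.
rewrite (_ : _ @^-1` _ =
    \bigcup_(a in [set a | f a = 0]) [set x | U (a + x)]).
  by apply: bigcup_open => a _; exact: open_translate.
apply/seteqP; split=> x /=.
  move=> [u Uu ux]; exists (u - x); last by rewrite /= subrK.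
  rewrite /= raddfB; apply/eqP; rewrite /= subr_eq0 -!(@quot_ker_map_pi _ _ f).
  by rewrite ux.
move=> [a /= fa Ux]; exists (a + x) => //.
by apply: pi_quot_ker_eq; rewrite raddfD /= fa add0r.
Qed.

Lemma open_at0_image : open_at0 f -> forall U, open U -> open (f @` U).
Proof.
move=> f0 U oU; rewrite openE => _ [x Ux <-]; apply: (nbhs_translate _ _).2.
have : nbhs 0 [set y | U (x + y)].
  by apply: (nbhs_translate x U).1; exact: open_nbhs_nbhs.
move=> /f0; apply: filterS => _ [y Uxy <-].
by exists (x + y) => //; rewrite raddfD.
Qed.

(** The projection onto the quotient by the kernel is open and the range of a
    surjection is closed, so both properties say that the induced bijection is
    a homeomorphism. *)
Lemma strict_surjP : surjective f -> strict f <-> open_at0 f.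
Proof.
move=> fsurj; split.
  move=> [[_ indf] _] U; rewrite nbhsE => -[W [oW W0] WU].
  have [V oV VW] := (indf _).1 (pi_quot_ker_open oW).
  apply: (@filterS _ _ _ V); last first.
    apply: open_nbhs_nbhs; split => //.
    suff: (@quot_ker_map A B f @^-1` V) (\pi 0).
      by rewrite /preimage/= quot_ker_map_pi raddf0.
    by rewrite VW; exists 0.
  move=> v Vv; have [x _ xv] := fsurj v I.
  have : (@quot_ker_map A B f @^-1` V) (\pi x).
    by rewrite /preimage/= quot_ker_map_pi xv.
  rewrite VW => -[w Ww wx]; exists w; first exact: WU.
  by rewrite -xv -!(@quot_ker_map_pi _ _ f) wx.
move=> f0; split; last first.
  rewrite (_ : range _ = setT); first exact: closedT.
  apply/seteqP; split=> // y _; have [x _ <-] := fsurj y I.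
  by exists (\pi x) => //; rewrite quot_ker_map_pi.
split; first exact: quot_ker_map_inj.
move=> U; split=> [oU|[V oV <-]].
  exists (@quot_ker_map A B f @` U).
    rewrite (_ : _ @` U = f @` (\pi_(quot_ker f) @^-1` U)).
      exact: open_at0_image.
    apply/seteqP; split=> [_ [q Uq <-]|_ [x Ux <-]].
      by exists (repr q) => //=; rewrite reprK.
    by exists (\pi x) => //; rewrite quot_ker_map_pi.
  apply/seteqP; split=> [q [p Up /quot_ker_map_inj <-]//|q Uq].
  by exists q.
rewrite /open/= /quotient_open.
rewrite (_ : _ @^-1` _ = f @^-1` V); last first.
  by apply/seteqP; split=> x /=; rewrite quot_ker_map_pi.
have /continuousP : continuous f by move=> x; exact: cts_fun.
exact.
Qed.

End strict_surjection.

(** * Small extensions of small partial homomorphisms *)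

Definition small_on (A D : zmodType) (K : set A) (O : set D) (G : set (A * D)) :
  Prop := forall x e, G (x, e) -> K x -> O e.

(** This is openness at [0] of the restriction from homomorphisms on [H'] to
    those on [H] in the compact-open topologies. Continuity is left out: it is
    automatic for extensions from an open subgroup, and without it no topology
    on the intermediate subgroups is required. *)
Definition open_extension (A D : topologicalZmodType) (H H' : set A) : Prop :=
  forall K (O : set D), compact K -> K `<=` H' -> nbhs 0 O ->
  exists K' N, [/\ compact K', K' `<=` H, nbhs 0 N &
    forall G, partial_hom G -> dom G = H -> small_on K' N G ->
    exists G', [/\ partial_hom G', G `<=` G', dom G' = H' & small_on K O G']].

Section small_extension.
Variables A D : topologicalZmodType.
Implicit Types (H K : set A) (O W : set D) (G : set (A * D)) (a : A).

Lemma open_extension_refl H : open_extension D H H.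
Proof.
move=> K O cK KH O0; exists K, O; split => // G pG domG sG.
by exists G; split.
Qed.

Lemma open_extension_trans H1 H2 H3 :
  open_extension D H1 H2 -> open_extension D H2 H3 -> open_extension D H1 H3.
Proof.
move=> ext12 ext23 K O cK KH O0.
have [K2 [N2 [cK2 K2H N20 ext2]]] := ext23 _ _ cK KH O0.
have [K1 [N1 [cK1 K1H N10 ext1]]] := ext12 _ _ cK2 K2H N20.
exists K1, N1; split => // G pG domG sG.
have [G2 [pG2 GG2 domG2 sG2]] := ext1 G pG domG sG.
have [G3 [pG3 GG3 domG3 sG3]] := ext2 G2 pG2 domG2 sG2.
by exists G3; split => //; exact: subset_trans GG3.
Qed.

Hypothesis open_mulrn : forall n (U : set D), (0 < n)%N -> nbhs 0 U ->
  nbhs 0 [set d *+ n | d in U].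

(** In the torsion case the compact set is a single point, the least positive
    multiple of [a] in [H]. *)
Lemma partial_hom_small_value H a W : subgroup H -> nbhs 0 W ->
  exists K N, [/\ compact K, K `<=` H, nbhs 0 N &
    forall G, partial_hom G -> dom G = H -> small_on K N G ->
    exists2 d, W d & forall k e, G (a *~ k, e) -> e = d *~ k].
Proof.
move=> sH W0; have [Hk|[n [n0 Hn nP]]] := multiples_in_subgroup a sH.
  exists set0, setT; split; [exact: compact0|exact: sub0set|exact: filterT|].
  move=> G pG domG _; exists 0; first exact: nbhs_singleton.
  move=> k e Gk; have k0 : k = 0 by apply: Hk; rewrite -domG; exists e.
  by rewrite mul0rz; apply: pG.2; rewrite k0 mulr0z in Gk.
exists [set a *+ n], [set d *+ n | d in W].
split; [exact: compact_set1|by move=> _ ->|exact: open_mulrn|].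
move=> G pG domG sG; have [e Ge] : dom G (a *+ n) by rewrite domG.
have [d Wd de] := sG _ _ Ge erefl.
by exists d => //; apply: partial_hom_root Ge de; rewrite // domG.
Qed.

Lemma nbhs0_addMz (s : seq int) O : nbhs 0 O ->
  exists2 W : set D, nbhs 0 W &
    forall k d e, k \in s -> W d -> W e -> O (e + d *~ k).
Proof.
move=> O0; elim: s => [|k s [W W0 WO]].
  by exists setT => //; exact: filterT.
have ctk : {for ((0, 0) : D * D),
    continuous (fun p : D * D => p.1 + p.2 *~ k)}.
  apply: (@continuous_comp _ _ _ (fun p : D * D => (p.1, p.2 *~ k))
    (fun p : D * D => p.1 + p.2)); last exact: add_continuous.
  apply: cvg_pair; first exact: cvg_fst.
  apply: (@continuous_comp _ _ _ snd (fun e : D => e *~ k)).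
    exact: cvg_snd.
  exact: mulrz_continuous.
have [|[U1 U2] /= [U10 U20] UO] := ctk O; first by rewrite /= mul0rz addr0.
exists (W `&` (U1 `&` U2)); first by do ![apply: filterI => //].
move=> l d e; rewrite inE => /orP[/eqP->|ls] [Wd [U1d U2d]] [We [U1e U2e]].
  exact: (UO (e, d)).
exact: WO.
Qed.

(** The compact set for [H] collects the one that controls the value at [a] and
    the pieces of [K] in the finitely many cosets [k a + H], moved into [H];
    these pieces are compact because [H] is closed. *)
Lemma open_extension_adjoin H a :
  subgroup H -> open H -> open_extension D H (adjoin H a).
Proof.
move=> sH oH K O cK KH O0.
have [s sK] := compact_cosets (c := fun k : int => a *~ k) sH oH cK KH.
have [W W0 WO] := nbhs0_addMz s O0.
have [K1 [N1 [cK1 K1H N10 value]]] := partial_hom_small_value a sH W0.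
pose K2 := \bigcup_(k in [set` s]) ([set y | K (a *~ k + y)] `&` H).
exists (K1 `|` K2), (N1 `&` W); split.
- apply: compactU => //; rewrite /K2 bigcup_seq.
  apply: bigsetU_compact => k _; apply: compact_closedI.
    exact: compact_translate.
  exact: open_subgroup_closed.
- by rewrite subUset; split => // y [k _ []].
- exact: filterI.
move=> G pG domG sG.
have [|d Wd dP] := value G pG domG.
  by move=> x e Gxe Kx; apply: (sG _ _ Gxe _).1; left.
exists (adjoin G (a, d)); split.
- exact: partial_hom_adjoin.
- exact: sub_adjoin.
- by rewrite dom_adjoin domG.
(* By uniqueness of values, [e] can be computed from a decomposition of [x]
   whose coefficient [k] is in the finite list [s]. *)
move=> x e Gxe Kx; have [k ks] := sK x Kx; rewrite -domG => -[f Gf].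
have Gf' : adjoin G (a, d) (x, f + d *~ k).
  exists k; rewrite mulrz_pair.
  by change (G (x - a *~ k, f + d *~ k - d *~ k)); rewrite addrK.
rewrite (partial_hom_uniq (partial_hom_adjoin pG dP) Gxe Gf').
apply: WO => //; apply: (sG _ _ Gf _).2; right; exists k => //=.
split; first by rewrite addrC subrK.
by rewrite -domG; exists f.
Qed.

Definition adjoins H (s : seq A) : set A := foldr (fun a H => adjoin H a) H s.

Lemma open_extension_adjoins H s : subgroup H -> open H ->
  [/\ subgroup (adjoins H s), open (adjoins H s) &
      open_extension D H (adjoins H s)].
Proof.
move=> sH oH; elim: s => [|a s [sHs oHs ext]].
  by split => //; exact: open_extension_refl.
split; [exact: subgroup_adjoin|exact: open_adjoin|].
by apply: open_extension_trans ext _; exact: open_extension_adjoin.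
Qed.

Lemma coset_sub_adjoins H s a x : a \in s -> H (x - a) -> adjoins H s x.
Proof.
have sub t : H `<=` adjoins H t.
  by elim: t => // b t IH y Hy; apply: sub_adjoin; exact: IH.
elim: s => // b s IH; rewrite inE => /orP[/eqP-> Hx|/IH{}IH /IH Hx].
  by exists 1; rewrite mulr1z; exact: sub.
exact: sub_adjoin.
Qed.

Lemma small_total_extension H K O : nat_divisible D -> subgroup H -> open H ->
  compact K -> nbhs 0 O ->
  exists K' N, [/\ compact K', K' `<=` H, nbhs 0 N &
    forall G, partial_hom G -> dom G = H -> small_on K' N G ->
    exists g : A -> D, [/\ nmod_morphism g, forall x e, G (x, e) -> g x = e &
      forall x, K x -> O (g x)]].
Proof.
move=> divD sH oH cK O0.
have [|s sK] := compact_cosets (c := id) sH oH cK.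
  by move=> x _; exists x; rewrite subrr; exact: sH.1.
have [_ _ ext] := open_extension_adjoins s sH oH.
have [|K' [N [cK' K'H N0 {}ext]]] := ext K O cK _ O0.
  by move=> x /sK[a]; exact: coset_sub_adjoins.
exists K', N; split => // G pG domG /(ext _ pG domG)[G' [pG' GG' domG' sG']].
have [g addg gG'] := partial_hom_extend divD pG'.
exists g; split => // [x e /GG'/gG'//|x Kx].
have [e Ge] : dom G' x.
  by rewrite domG'; have [a] := sK x Kx; exact: coset_sub_adjoins.
by rewrite (gG' _ _ Ge); exact: sG' Ge Kx.
Qed.

End small_extension.

(** * Restriction to an open subgroup *)

Section open_embedding_theory.
Variables (X Y : topologicalType) (g : X -> Y).
Hypothesis og : open_embedding g.

Lemma open_embedding_nbhs x U : nbhs x U -> nbhs (g x) (g @` U).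
Proof.
have [[_ gP] gX] := og; rewrite nbhsE => -[W [/gP[V oV VW] Wx] WU].
apply: (@filterS _ _ _ (V `&` range g)); last first.
  apply: open_nbhs_nbhs; split; first exact: openI.
  by split; [rewrite -VW in Wx|exists x].
by move=> z [Vz [y _ yz]]; exists y => //; apply: WU; rewrite -VW /= yz.
Qed.

(** An open embedding reflects cluster points that are in its range. *)
Lemma open_embedding_compact (K : set Y) :
  compact K -> K `<=` range g -> compact (g @^-1` K).
Proof.
move=> cK Kg F PF FK; have [y [Ky cly]] := cK (g @ F) _ FK.
have [x _ xy] := Kg _ Ky; rewrite -xy in Ky cly.
exists x; split => // U V FU /open_embedding_nbhs Vx.
have [|_ [[u Uu <-] [v Vv /og.1.1 vu]]] := cly (g @` U) _ _ Vx.
  by apply: (@filterS _ F _ U) => // u Uu; exists u.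
by exists u; split => //; rewrite -vu.
Qed.

End open_embedding_theory.

(** A single pair [(K, O)] suffices: finitely many conditions [h K_i <= O_i] are
    implied by the one for the union of the [K_i] and the intersection of the
    [O_i], which is still a neighbourhood of [0]. *)
Lemma contHom_nbhs0 (A D : topologicalZmodType) (U : set (contHom A D)) :
  nbhs 0 U -> exists K O, [/\ compact K, nbhs 0 O &
    forall h : contHom A D, (forall x, K x -> O (h x)) -> U h].
Proof.
pose F : set_system (contHom A D) :=
  [set U | exists K O, [/\ compact K, nbhs 0 O &
  forall h : contHom A D, (forall x, K x -> O (h x)) -> U h]].
have FF : Filter F.
  split.
  - by exists set0, setT; split => //; [exact: compact0|exact: filterT].
  - move=> P Q [K [ O [cK O0 KP]]] [L [N [cL N0 LQ]]].
    exists (K `|` L), (O `&` N); split; [exact: compactU|exact: filterI|].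
    by move=> h hKL; split; [apply: KP|apply: LQ] => x Kx; have [] := hKL x;
      rewrite //; [left|right].
  - move=> P Q PQ [K [ O [cK O0 KP]]]; exists K, O; split => // h /KP.
    exact: PQ.
(* The sets [U] as in the conclusion form a filter, so it is enough that it
   contains the subbasic neighbourhoods of [0]. *)
suff : F --> (0 : contHom A D) by apply.
apply: (contHom_cvgP 0 FF).2 => K O cK oO KO.
(* If [K] is empty, then [O] need not contain [0]. *)
have [->|/set0P[x Kx]] := eqVneq K set0.
  exists set0, setT; split => [||h _ _ []//]; first exact: compact0.
  exact: filterT.
exists K, O; split => //; last by move=> h hK _ [y Ky <-]; exact: hK.
by apply: open_nbhs_nbhs; split => //; apply: KO; exists x.
Qed.

Section restriction.
Variables (A' A D : topologicalZmodType) (iota : contHom A' A).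
Hypothesis hiota : open_embedding iota.

Lemma subgroup_range : subgroup (range iota).
Proof.
split; first by exists 0; rewrite ?raddf0.
by move=> _ _ [x _ <-] [y _ <-]; exists (x - y) => //; rewrite raddfB.
Qed.

(** Additive maps are continuous as soon as they are continuous at [0], and the
    image of [iota] is a neighbourhood of [0]. *)
Lemma contHom_extend (g : contHom A' D) (f : A -> D) :
  nmod_morphism f -> (forall x, f (iota x) = g x) ->
  exists2 h : contHom A D, h =1 f & pullback D iota h = g.
Proof.
move=> [f0 fD] fg; have ctf : continuous f.
  move=> x W /nbhs_translate Wf; apply: (nbhs_translate _ _).2.
  have : nbhs 0 (g @^-1` [set e | W (f x + e)]).
    have Wg : nbhs (g 0) [set e | W (f x + e)] by rewrite raddf0.
    exact: (@cts_fun _ _ g 0 _ Wg).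
  move=> /(open_embedding_nbhs hiota); rewrite raddf0; apply: filterS.
  by move=> _ [y Wy <-]; rewrite /= fD fg.
pose h : contHom A D := HB.pack f (isContinuous.Build A D f ctf)
  (GRing.isNmodMorphism.Build A D f (f0, fD)).
by exists h => //; apply/contHomP => x; exact: fg.
Qed.

Definition graph_along (g : contHom A' D) : set (A * D) :=
  range (fun x => (iota x, g x)).

Lemma partial_hom_graph g : partial_hom (graph_along g).
Proof.
split; first split.
- by exists 0 => //; rewrite !raddf0.
- move=> _ _ [x _ <-] [y _ <-]; exists (x - y) => //.
  by rewrite !raddfB.
move=> e [x _ [x0 <-]]; rewrite (_ : x = 0) ?raddf0//.
by apply: hiota.1.1; rewrite raddf0.
Qed.

Lemma dom_graph g : dom (graph_along g) = range iota.
Proof.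
apply/seteqP; split=> [_ [e [x _ [<- _]]]|_ [x _ <-]]; first by exists x.
by exists (g x), x.
Qed.

Lemma pullback_surjective : nat_divisible D -> surjective (pullback D iota).
Proof.
move=> divD g _.
have [f addf fg] := partial_hom_extend divD (partial_hom_graph g).
have [|h _ hg] := @contHom_extend g f addf; last by exists h.
by move=> x; apply: fg; exists x.
Qed.

Lemma pullback_open_at0 : nat_divisible D ->
  (forall n (U : set D), (0 < n)%N -> nbhs 0 U ->
     nbhs 0 [set d *+ n | d in U]) ->
  open_at0 (pullback D iota).
Proof.
move=> divD opD U /contHom_nbhs0[K [ O [cK O0 KU]]].
have [K' [N [cK' K'A N0 ext]]] :=
  small_total_extension opD divD subgroup_range hiota.2 cK O0.
have cK'' := open_embedding_compact hiota cK' K'A.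
apply: filterS (contHom_nbhs cK'' (@open_interior _ N) _); last first.
  by move=> _ [x _ <-]; exact: N0.
move=> g gN.
have [|f [addf fg fK]] := ext _ (partial_hom_graph g) (dom_graph g).
  by move=> _ _ [x _ [<- <-]] K'x; apply: interior_subset; apply: gN; exists x.
have [|h hf hg] := @contHom_extend g f addf.
  by move=> x; apply: fg; exists x.
by exists h => //; apply: KU => x Kx; rewrite hf; exact: fK.
Qed.

End restriction.

Theorem proposition3p3 (A' A D : topologicalZmodType) (iota : contHom A' A)
    (hA' : lca_group A') (hA : lca_group A) (hD : lca_group D)
    (hiota : open_embedding iota) :
  (divisible D -> surjective (pullback D iota)) /\
  (strictly_divisible D ->
     strict (pullback D iota) /\ surjective (pullback D iota)).
Proof.
have divP : divisible D -> nat_divisible D.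
  by move=> divD n e n0; have [d _ <-] := divD n n0 e I; exists d.
split=> [/divP|sdivD]; first exact: pullback_surjective.
have divD : nat_divisible D by apply: divP => n /sdivD[].
have surj := pullback_surjective hiota divD.
split => //; apply/(strict_surjP surj); apply: pullback_open_at0 => // n U n0.
by have [strn surjn] := sdivD n n0; exact: (strict_surjP surjn).1.
Qed.
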